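(* Let $d \ge 1$ and let $P=\{p_1,\ldots,p_d\}$ and $Q=\{q_1,\ldots,q_d\}$ be finite posets with $d$ elements each. (1) If $P$ and $Q$ possess a common linear extension, then $\Omega(\mathcal{O}_P,\mathcal{O}_Q)\subset\mathbb{R}^{d+1}$ is a normal Gorenstein Fano polytope. (2) Each of $\Omega(\mathcal{O}_P,\mathcal{C}_Q)$ and $\Omega(\mathcal{C}_P,\mathcal{C}_Q)$ in $\mathbb{R}^{d+1}$ is a normal Gorenstein Fano polytope (with no assumption on common linear extensions).
   Context: Linear extensions. A linear extension of a finite poset $P=\{p_1,\ldots,p_d\}$ is a permutation $\sigma=i_1i_2\cdots i_d$ of $[d]=\{1,\ldots,d\}$ such that $a<b$ whenever $p_{i_a}<p_{i_b}$ in $P$. Posets $P=\{p_1,\ldots,p_d\}$ and $Q=\{q_1,\ldots,q_d\}$ possess a common linear extension if some permutation of $[d]$ is a linear extension of both $P$ and $Q$. Order polytope. $\mathcal{O}_P\subset\mathbb{R}^d$ is the set of $(x_1,\ldots,x_d)$ with $0\le x_i\le 1$ for $1\le i\le d$ and $x_i\ge x_j$ whenever $p_i\le p_j$ in $P$. Chain polytope. $\mathcal{C}_P\subset\mathbb{R}^d$ is the set of $(x_1,\ldots,x_d)$ with $x_i\ge 0$ for $1\le i\le d$ and $x_{i_1}+\cdots+x_{i_k}\le 1$ for every maximal chain $p_{i_1}<\cdots<p_{i_k}$ of $P$. Both are integral convex polytopes of dimension $d$ (an integral convex polytope is one all of whose vertices have integer coordinates). The polytopes $\mathcal{O}_Q,\mathcal{C}_Q$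 are defined likewise from $Q$ (with $q_i$ in place of $p_i$). For integral convex polytopes $\mathcal{P},\mathcal{Q}\subset\mathbb{R}^d$ of dimension $d$, $$\Omega(\mathcal{P},\mathcal{Q})=\operatorname{conv}\{(\mathcal{P}\times\{1\})\cup((-\mathcal{Q})\times\{-1\})\}\subset\mathbb{R}^{d+1},$$ which is an integral convex polytope of dimension $d+1$; here $-\mathcal{Q}=\{-y: y\in\mathcal{Q}\}$. An integral convex polytope $\mathcal{P}\subset\mathbb{R}^n$ of dimension $n$ is Gorenstein Fano (reflexive) if the origin of $\mathbb{R}^n$ is the unique lattice point (point of $\mathbb{Z}^n$) in the interior of $\mathcal{P}$ and the dual polytope $\mathcal{P}^\vee=\{\mathbf{x}\in\mathbb{R}^n:\langle\mathbf{x},\mathbf{y}\rangle\le 1\text{ for all }\mathbf{y}\in\mathcal{P}\}$ is again integral. An integral convex polytope $\mathcal{P}\subset\mathbb{R}^n$ of dimension $n$ is normal if for each integer $N>0$ and each $\mathbf{a}\in N\mathcal{P}\cap\mathbb{Z}^n$ there exist $\mathbf{a}_1,\ldots,\mathbf{a}_N\in\mathcal{P}\cap\mathbb{Z}^n$ with $\mathbf{a}=\mathbf{a}_1+\cdots+\mathbf{a}_N$, where $N\mathcal{P}=\{N\alpha:\alpha\in\mathcal{P}\}$. *)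

(* Defs.v *)
From HB Require Import structures.
From mathcomp Require Import all_boot all_order perm all_algebra.
From mathcomp Require Import all_classical all_reals.
From mathcomp Require Import topology normedtype convex.

Set Implicit Arguments.
Unset Strict Implicit.
Unset Printing Implicit Defensive.

Import Order.TTheory GRing.Theory Num.Theory.
Import numFieldNormedType.Exports.

Local Open Scope classical_set_scope.
Local Open Scope ring_scope.

Section Polytopes.
Variables (R : realType) (n : nat).
Implicit Types (A : set 'rV[R]_n) (x y : 'rV[R]_n).

Definition dotp x y : R := \sum_(i < n) x 0 i * y 0 i.

Definition lattice_point x : Prop := x \is a mxOver Num.int.

Definition convex_hull A : set 'rV[R]_n := smallest (@convex_set R 'rV[R]_n) A.

Definition convex_polytope A : Prop :=
  exists F : set 'rV[R]_n, finite_set F /\ A = convex_hull F.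

(* The zero-dimensional faces: [x] is the unique maximizer on [A] of some
   linear functional. *)
Definition vertex A x : Prop :=
  A x /\ exists c, forall y, A y -> y != x -> dotp c y < dotp c x.

Definition integral_polytope A : Prop :=
  convex_polytope A /\ forall x, vertex A x -> lattice_point x.

(* The affine hull of [A] has dimension [k]: the points [x0] and
   [x0 + row i M] form an affine basis of it, taken inside [A]. *)
Definition has_dim A (k : nat) : Prop :=
  exists (x0 : 'rV[R]_n) (M : 'M[R]_(k, n)),
    [/\ row_free M, A x0, forall i, A (x0 + row i M)
      & forall x, A x -> (x - x0 <= M)%MS].

Definition full_dim_integral_polytope A : Prop :=
  integral_polytope A /\ has_dim A n.

Definition dual_polytope A : set 'rV[R]_n :=
  [set x | forall y, A y -> dotp x y <= 1].

Definition dilate (N : nat) A : set 'rV[R]_n := [set N%:R *: x | x in A].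

Definition gorenstein_fano A : Prop :=
  [/\ full_dim_integral_polytope A,
      interior A `&` lattice_point = [set 0]
    & integral_polytope (dual_polytope A)].

Definition normal_polytope A : Prop :=
  full_dim_integral_polytope A /\
  forall N : nat, (0 < N)%N ->
  forall a, dilate N A a -> lattice_point a ->
  exists b : 'I_N -> 'rV[R]_n,
    (forall k, A (b k) /\ lattice_point (b k)) /\ a = \sum_(k < N) b k.

End Polytopes.

(* R^(d+1) is ['rV_(d + 1)], the additional coordinate being the last one. *)
Definition Omega (R : realType) (d : nat) (A B : set 'rV[R]_d) :
    set 'rV[R]_(d + 1) :=
  convex_hull ([set row_mx x (const_mx 1) | x in A] `|`
               [set row_mx (- y) (const_mx (- 1)) | y in B]).

(* A poset [P] = {p_1, ..., p_d} is given with its enumeration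
   [p : 'I_d -> P], assumed to be bijective where these notions are used. *)
Section Posets.
Variables (d : nat) (disp : Order.disp_t) (P : finPOrderType disp).
Variable p : 'I_d -> P.

Definition linear_extension (s : 'S_d) : Prop :=
  forall a b : 'I_d, (p (s a) < p (s b))%O -> (a < b)%N.

Definition chain (C : {set P}) : bool :=
  [forall x in C, forall y in C, (x >=< y)%O].

Definition order_polytope (R : realType) : set 'rV[R]_d :=
  [set x | (forall i, 0 <= x 0 i <= 1) /\
           forall i j, (p i <= p j)%O -> x 0 j <= x 0 i].

Definition chain_polytope (R : realType) : set 'rV[R]_d :=
  [set x | (forall i, 0 <= x 0 i) /\
           forall C : {set P}, maxset chain C ->
             \sum_(i < d | p i \in C) x 0 i <= 1].

End Posets.

Arguments order_polytope {d disp P} p R.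
Arguments chain_polytope {d disp P} p R.

Definition common_linear_extension (d : nat) (dispP dispQ : Order.disp_t)
    (P : finPOrderType dispP) (Q : finPOrderType dispQ)
    (p : 'I_d -> P) (q : 'I_d -> Q) : Prop :=
  exists s : 'S_d, linear_extension p s /\ linear_extension q s.

(* Main.v *)
Require Import Defs.
From mathcomp Require Import all_boot all_order all_algebra.
From mathcomp Require Import all_classical all_reals.
From mathcomp Require Import topology normedtype convex.
From mathcomp Require Import perm interval_inference ring lra zify.

Set Implicit Arguments.
Unset Strict Implicit.
Unset Printing Implicit Defensive.

Import Order.TTheory GRing.Theory Num.Theory.
Import numFieldNormedType.Exports.

Local Open Scope classical_set_scope.
Local Open Scope ring_scope.

(** Write Omega for the polytope of a pair (A, B), where A and B are order or
    chain polytopes.  For t in [-r, r], a point (x, t) lies in r * Omega exactly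
    when x = u - v with u in a * A and v in b * B, where a = (r + t) / 2 and
    b = (r - t) / 2.

    The theorem rests on rounding down.  All the inequalities that define an
    order or a chain polytope survive floors: if u lies in a * A, then
    coordinatewise floor u lies in floor a * A, because floor is monotone
    (order polytope) and superadditive (chain polytope).  If (x, t) is integral
    then u - v = x and a - b = t are integral, so that
    floor u - floor v = x and floor a - floor b = t.  Hence a lattice point of
    r * Omega already lies in N * Omega for N = floor a + floor b, an integer
    that is at most r: the gauge of Omega is integral at lattice points
    ([omega_gauge_floor]).  Moreover the witnesses are then lattice points of
    integral dilations of A and B, and from these a lattice point of A or B can
    be split off: the support of u for an order polytope, the minimal elements
    of the support for a chain polytope.

    A polytope whose gauge is integral at lattice points, whose
    integral dilations split in this way and which contains a neighbourhood of
    the origin is normal and Gorenstein Fano ([lattice_gauge_polytope]).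
    - The origin is the only interior lattice point, since an interior lattice
      point has gauge less than 1, hence gauge 0.
    - Omega is the hull of its lattice points.  Otherwise an integral functional
      c separates one of its points y from them with a uniform gap; but
      floor (N y) is within a bounded error of N y and a sum of N + O(1)
      lattice points of Omega, which is impossible for large N.
    - The dual is the hull of its lattice points.  Otherwise some integral c
      separates a point of the dual from them; but an integer version of the
      Hahn-Banach theorem ([int_hahn_banach]) provides a lattice point of the
      dual at which c takes the value gauge c, the largest value that it could
      take on the dual.
    The separations come from Farkas' lemma.

    The hypothesis on linear extensions serves only to put the origin into the
    interior of Omega: this requires a common interior point of A and B, and a
    point is interior to an order polytope only if its coordinates decrease
    strictly along the order.  A chain polytope contains all small positive
    vectors, which is why it imposes no condition. *)

(** * Dot products and Farkas' lemma *)

Section DotProduct.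
Variables (R : realType) (n : nat).
Implicit Types x y z : 'rV[R]_n.

Lemma dotpC x y : dotp x y = dotp y x.
Proof. by apply: eq_bigr => i _; rewrite mulrC. Qed.

Lemma dotpDl x y z : dotp (x + y) z = dotp x z + dotp y z.
Proof. by rewrite -big_split; apply: eq_bigr => i _; rewrite mxE mulrDl. Qed.

Lemma dotpZl a x y : dotp (a *: x) y = a * dotp x y.
Proof. by rewrite [RHS]mulr_sumr; apply: eq_bigr => i _; rewrite mxE mulrA. Qed.

Lemma dotpDr x y z : dotp x (y + z) = dotp x y + dotp x z.
Proof. by rewrite dotpC dotpDl !(dotpC x). Qed.

Lemma dotpZr a x y : dotp x (a *: y) = a * dotp x y.
Proof. by rewrite dotpC dotpZl (dotpC x). Qed.

Lemma dotpBl x y z : dotp (x - y) z = dotp x z - dotp y z.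
Proof. by rewrite -scaleN1r dotpDl dotpZl mulN1r. Qed.

Lemma dotpBr x y z : dotp x (y - z) = dotp x y - dotp x z.
Proof. by rewrite -scaleN1r dotpDr dotpZr mulN1r. Qed.

Lemma dotp0r x : dotp x 0 = 0.
Proof. by rewrite -(scale0r 0) dotpZr mul0r. Qed.

Lemma dotp_sumr (I : Type) (r : seq I) (F : I -> 'rV[R]_n) x :
  dotp x (\sum_(i <- r) F i) = \sum_(i <- r) dotp x (F i).
Proof.
elim: r => [|i r IH]; first by rewrite !big_nil dotp0r.
by rewrite !big_cons dotpDr IH.
Qed.

Lemma dotp_delta x i : dotp x (delta_mx 0 i) = x 0 i.
Proof.
rewrite /dotp (bigD1 i)//= mxE !eqxx mulr1 big1 ?addr0// => j ji.
by rewrite mxE (negPf ji) andbF mulr0.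
Qed.

Lemma dotp_le_norm x y : (forall i, `|x 0 i| <= 1) ->
  dotp x y <= \sum_i `|y 0 i|.
Proof.
move=> x1; apply: ler_sum => i _; apply: (le_trans (ler_norm _)).
by rewrite normrM ler_piMl.
Qed.

Lemma dotp_self_le0 x : dotp x x <= 0 -> x = 0.
Proof.
move=> xx0; have /eqP : dotp x x == 0.
  by rewrite eq_le xx0 sumr_ge0// => i _; rewrite -expr2 sqr_ge0.
move=> /psumr_eq0P x0; apply/rowP => i; rewrite mxE; apply/eqP.
by rewrite -sqrf_eq0 expr2 x0// => j _; rewrite -expr2 sqr_ge0.
Qed.

End DotProduct.

Lemma dotp_row_mx (R : realType) (m n : nat) (a c : 'rV[R]_m) (b d : 'rV[R]_n) :
  dotp (row_mx a b) (row_mx c d) = dotp a c + dotp b d.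
Proof.
rewrite /dotp big_split_ord; congr +%R; apply: eq_bigr => i _.
  by rewrite !row_mxEl.
by rewrite !row_mxEr.
Qed.

Section Farkas.
Variables (R : realType) (n : nat).

(** Induction on the number m of generators (an argument of Bartl): if the
    conclusion does not follow without the last generator, then some x0 witnesses
    this, and projecting along x0 removes that generator. *)
Lemma farkas m (a : nat -> 'rV[R]_n) (b : 'rV[R]_n) :
  (forall x, (forall i, (i < m)%N -> dotp (a i) x <= 0) -> dotp b x <= 0) ->
  exists2 l : nat -> R, forall i, 0 <= l i & b = \sum_(i < m) l i *: a i.
Proof.
elim: m a b => [|m IH] a b ab.
  exists (fun=> 0) => //; rewrite big_ord0; apply: dotp_self_le0.
  by apply: ab => i.
have [abm|] := pselect (forall x,
    (forall i, (i < m)%N -> dotp (a i) x <= 0) -> dotp b x <= 0).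
  have [l l0 ->] := IH _ _ abm; exists (fun i => if i == m then 0 else l i).
    by move=> i; case: eqP.
  rewrite big_ord_recr/= eqxx scale0r addr0; apply: eq_bigr => i _.
  by rewrite (ltn_eqF (ltn_ord i)).
move=> /existsNP[x0 /not_implyP[ax0 /negP]]; rewrite -ltNge => bx0.
have am0 : 0 < dotp (a m) x0.
  rewrite ltNge; apply/negP => amx0; move: bx0; rewrite ltNge ab// => i.
  by rewrite ltnS leq_eqVlt => /orP[/eqP->//|]; exact: ax0.
pose t := (dotp (a m) x0)^-1; have t0 : 0 < t by rewrite invr_gt0.
(* [proj c] is the functional x |-> c (x - x'), where x' is the multiple of x0
   with the same value under [a m] as x; so [proj (a m)] vanishes. *)
pose proj (c : 'rV[R]_n) := c - (t * dotp c x0) *: a m.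
have projE c x : dotp (proj c) x = dotp c (x - (t * dotp (a m) x) *: x0).
  by rewrite dotpBl dotpBr dotpZl dotpZr; ring.
have [|l l0 lE] := IH (proj \o a) (proj b).
  move=> x px; rewrite projE; apply: ab => i; rewrite ltnS leq_eqVlt.
  case/orP=> [/eqP->|im]; last by rewrite -projE px.
  by rewrite dotpBr dotpZr mulrAC mulVf ?gt_eqF// mul1r subrr.
exists (fun i => if i == m then
    t * dotp b x0 - t * \sum_(j < m) l j * dotp (a j) x0 else l i).
  move=> i; case: eqP => // _; rewrite -mulrBr mulr_ge0 ?(ltW t0)// subr_ge0.
  apply: (le_trans _ (ltW bx0)); apply: sumr_le0 => j _.
  by rewrite mulr_ge0_le0// ax0.
rewrite big_ord_recr/= eqxx -[LHS](subrK ((t * dotp b x0) *: a m)).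
rewrite -/(proj b) lE scalerBl addrCA [LHS]addrC; congr (_ + _).
rewrite [X in _ - X *: _]mulr_sumr scaler_suml -sumrB; apply: eq_bigr => i _.
rewrite (ltn_eqF (ltn_ord i)) scalerBr scalerA.
by congr (_ - _ *: _); ring.
Qed.

End Farkas.

(** * Convex hulls of finite sets *)

Section ConvexHull.
Variables (R : realType) (n : nat).
Implicit Types (A B : set 'rV[R]_n) (x y c : 'rV[R]_n).

Lemma convex_setE A : @convex_set R 'rV[R]_n A <->
  forall x y t, 0 <= t <= 1 -> A x -> A y -> A (t *: x + (1 - t) *: y).
Proof.
split=> [cA x y t /andP[t0 t1] /mem_set xA /mem_set yA|cA x y t].
  have t01 : Itv.spec (@Itv.num_sem R) (Itv.Real `[0%Z, 1%Z]) t.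
    by apply/and3P; split; rewrite ?num_real ?bnd_simp.
  by have := set_mem (cA x y (Itv.mk t01) xA yA).
by rewrite !inE; apply: cA; rewrite ge0 le1.
Qed.

Lemma convex_convex_hull A : @convex_set R 'rV[R]_n (convex_hull A).
Proof.
apply/convex_setE => x y t t01 hx hy B [cB AB].
by apply: (convex_setE B).1 => //; [exact: hx | exact: hy].
Qed.

Lemma convex_dual_polytope A : @convex_set R 'rV[R]_n (dual_polytope A).
Proof.
apply/convex_setE => x y t /andP[t0 t1] hx hy z Az; rewrite dotpDl !dotpZl.
have := hx z Az; have := hy z Az; nra.
Qed.

Lemma convex_halfspace c b : @convex_set R 'rV[R]_n [set x | dotp c x <= b].
Proof.
apply/convex_setE => x y t /andP[t0 t1] /= hx hy; rewrite dotpDr !dotpZr; nra.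
Qed.

Lemma sub_convex_hull A : A `<=` convex_hull A.
Proof. exact: sub_smallest. Qed.

Lemma convex_hull_sub A B : @convex_set R 'rV[R]_n B -> A `<=` B ->
  convex_hull A `<=` B.
Proof. exact: smallest_sub. Qed.

Lemma convex_comb A m (l : nat -> R) (a : nat -> 'rV[R]_n) :
  @convex_set R 'rV[R]_n A -> (forall i, (i < m)%N -> A (a i)) ->
  (forall i, 0 <= l i) -> \sum_(i < m) l i = 1 ->
  A (\sum_(i < m) l i *: a i).
Proof.
move=> /convex_setE cA + l0.
(* Normalizing by the total weight s makes the number of points inductive. *)
suff H s : 0 < s -> (forall i, (i < m)%N -> A (a i)) -> \sum_(i < m) l i = s ->
    A (s^-1 *: \sum_(i < m) l i *: a i).
  by move=> /H /[apply] /(_ ltr01); rewrite invr1 scale1r.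
elim: m s => [|m IH] s s0 Aa.
  by rewrite !big_ord0 => s_0; move: s0; rewrite -s_0 ltxx.
rewrite !big_ord_recr/=; set u := \sum_(i < m) l i => us.
have Aa' i : (i < m)%N -> A (a i) by move=> im; apply/Aa/ltnW.
have : 0 <= u by exact: sumr_ge0.
rewrite le_eqVlt => /predU1P[u0|u0].
  rewrite big1 => [|i _]; last first.
    by have /esym/psumr_eq0P -> := u0; rewrite ?scale0r.
  have <- : l m = s by rewrite -us -u0 add0r.
  have lm : l m != 0 by rewrite -[l m]add0r {1}u0 us gt_eqF.
  by rewrite add0r scalerA mulVf// scale1r; exact: Aa.
have := cA _ _ (u / s) _ (IH u u0 Aa' erefl) (Aa m (ltnSn m)).
rewrite scalerA scalerDr scalerA.
have -> : u / s / u = s^-1 by rewrite mulrAC mulfV ?mul1r ?gt_eqF.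
have -> : 1 - u / s = s^-1 * l m.
  have -> : l m = s - u by rewrite -us addrAC subrr add0r.
  by rewrite mulrBr mulVf ?lt0r_neq0// [u / s]mulrC.
apply; rewrite divr_ge0 ?(ltW s0) ?(ltW u0)//= ler_pdivrMr// mul1r -us.
by rewrite lerDl.
Qed.

(** If a vertex were outside the generating set, then the open half-space where
    its functional is smaller would contain all the generators, hence the whole
    hull and the vertex itself. *)
Lemma vertex_convex_hull A x : vertex (convex_hull A) x -> A x.
Proof.
move=> [hx [c xmax]]; apply: contrapT => nAx.
have : [set y | dotp c y < dotp c x] x; last by rewrite /= ltxx.
apply: (convex_hull_sub _ _ hx) => [|y Ay]; last first.
  by apply: xmax; [exact: sub_convex_hull|apply: contra_notN nAx => /eqP <-].
apply/convex_setE => y z t /andP[t0 t1] /= hy hz; rewrite dotpDr !dotpZr.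
by have [t_gt0|t_le0] := ltP 0 t; nra.
Qed.

End ConvexHull.

Section Separation.
Variables (R : realType) (n : nat).
Implicit Types (F : set 'rV[R]_n) (x y c : 'rV[R]_n).

(** Farkas' lemma, applied in one more dimension to the points (f, 1). *)
Lemma separate_finite_hull F y : finite_set F -> ~ convex_hull F y ->
  exists c, forall f, F f -> dotp c f < dotp c y.
Proof.
move=> /finite_seqP[s ->] nFy.
pose lift (x : 'rV[R]_n) := row_mx x (const_mx 1 : 'rV[R]_1).
apply: contrapT => nsep.
have [|l l0 lE] := @farkas R (n + 1) (size s) (fun i => lift (nth 0 s i)) (lift y).
  move=> x hx; rewrite leNgt; apply/negP => xy; apply: nsep.
  exists (lsubmx x) => f sf; case/(nthP 0): (sf : f \in s) => i si <-.
  have := hx i si; have := xy; rewrite -[x]hsubmxK /lift !dotp_row_mx.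
  by rewrite row_mxKl ![dotp (lsubmx x) _]dotpC; lra.
apply: nFy.
have yE : y = \sum_(i < size s) l i *: nth 0 s i.
  have := congr1 lsubmx lE; rewrite row_mxKl linear_sum => ->.
  by apply: eq_bigr => i _; rewrite linearZ/= row_mxKl.
rewrite yE; apply: convex_comb => //; first exact: convex_convex_hull.
  by move=> i si; apply: sub_convex_hull; rewrite /= mem_nth.
have := congr1 (fun M => rsubmx M 0 0) lE; rewrite row_mxKr linear_sum.
rewrite summxE mxE => ->; apply: eq_bigr => i _.
by rewrite linearZ/= row_mxKr !mxE mulr1.
Qed.

Lemma eventually_all_seq (T : eqType) (s : seq T) (P : T -> nat -> Prop) :
  (forall f, f \in s -> exists N0, forall N, (N0 <= N)%N -> P f N) ->
  exists N, forall f, f \in s -> P f N.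
Proof.
move=> Ps; suff [N0 N0P] : exists N0, forall f, f \in s ->
  forall N, (N0 <= N)%N -> P f N by exists N0 => f /N0P; apply.
elim: s Ps => [|f s IH] Ps; first by exists 0%N.
have [N1 N1P] := Ps f (mem_head f s).
have [|N2 N2P] := IH; first by move=> g gs; apply: Ps; rewrite inE gs orbT.
exists (maxn N1 N2) => g; rewrite inE => /orP[/eqP->|gs] N; rewrite geq_max.
  by case/andP=> /N1P.
by case/andP=> _; exact: N2P.
Qed.

(** Finitely many strict inequalities persist under small perturbations of c,
    and [floor (N c) / N] tends to c. *)
Lemma separate_finite_hull_int F y : finite_set F -> ~ convex_hull F y ->
  exists c : 'rV[int]_n,
    forall f, F f -> dotp (map_mx intr c) f < dotp (map_mx intr c) y.
Proof.
move=> finF nFy; have [c cP] := separate_finite_hull finF nFy.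
have [s Fs] := (finite_seqP F).1 finF; rewrite Fs in cP *.
pose c' (N : nat) : 'rV[int]_n := map_mx (fun z => Num.floor (N%:R * z)) c.
have [|N NP] := @eventually_all_seq _ s (fun f N =>
    dotp (map_mx intr (c' N)) f < dotp (map_mx intr (c' N)) y); last first.
  by exists (c' N) => f /NP.
move=> f sf; have cf : 0 < dotp c (y - f) by rewrite dotpBr subr_gt0 cP.
pose b := \sum_i `|(y - f) 0 i|.
have [N0 N0P] : exists N0 : nat, b / dotp c (y - f) < N0%:R.
  by eexists; exact: truncnS_gt.
exists N0 => N N0N; rewrite -subr_gt0 -dotpBr.
have : dotp (N%:R *: c - map_mx intr (c' N)) (y - f) <= b.
  apply: dotp_le_norm => i; rewrite !mxE; set z := _ * c 0 i.
  have := floor_le z; have := floorD1_gt z; rewrite intrD.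
  by move=> *; rewrite ger0_norm; lra.
rewrite dotpBl dotpZl; have : b < N%:R * dotp c (y - f); last by lra.
by rewrite -ltr_pdivrMr// (lt_le_trans N0P)// ler_nat.
Qed.

End Separation.

(** * Integer-valued sublinear functions *)

Section IntegerHahnBanach.

Definition int_sublinear (V : zmodType) (g : V -> int) :=
  (forall x y, g (x + y) <= g x + g y) /\
  (forall (k : nat) x, g (x *+ k) = g x *+ k).

Lemma int_nonincreasing_stabilizes (h : nat -> int) (b : int) :
  (forall N, h N.+1 <= h N) -> (forall N, b <= h N) ->
  exists m, exists N0, forall N, (N0 <= N)%N -> h N = m.
Proof.
move=> hS bh.
have hD N k : h (N + k)%N <= h N.
  elim: k => [|k IH]; first by rewrite addn0.
  by rewrite addnS; exact: le_trans (hS _) IH.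
have exh : exists k, `[< exists N, `|h N - b|%N = k >].
  by exists `|h 0%N - b|%N; apply/asboolP; exists 0%N.
case: (ex_minnP exh) => k /asboolP[N0 N0k] kmin.
exists (h N0), N0 => N /subnKC <-; move: (N - N0)%N => l.
have : (k <= `|h (N0 + l)%N - b|)%N.
  by apply: kmin; apply/asboolP; exists (N0 + l)%N.
have := hD N0 l; have := bh N0; have := bh (N0 + l)%N; lia.
Qed.

Variable V : zmodType.
Implicit Types (g : V -> int) (c x y : V).

Lemma int_sublinear0 g : int_sublinear g -> g 0 = 0.
Proof. by move=> [_ gM]; rewrite -(mulr0n 0) gM. Qed.

Lemma int_sublinear_opp g x : int_sublinear g -> - g (- x) <= g x.
Proof.
move=> gS; have := gS.1 x (- x).
by rewrite subrr int_sublinear0// -lerBlDr sub0r.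
Qed.

(** g' is the directional derivative of g at c, that is, the limit of
    g (N c + x) - N g c.  As this sequence of integers is nonincreasing and
    bounded below, it is eventually constant, so that g' is again integral. *)
Lemma int_sublinear_linearize g c : int_sublinear g ->
  exists g', [/\ int_sublinear g', forall x, g' x <= g x, g' c = g c
    & g' (- c) = - g c].
Proof.
move=> gS; have [gD gM] := gS.
have stab x : exists m, exists N0, forall N, (N0 <= N)%N ->
    g (c *+ N + x) - g c *+ N = m.
  apply: (@int_nonincreasing_stabilizes _ (- g (- x))) => N.
    by have := gD c (c *+ N + x); rewrite addrA -mulrS [g c *+ _]mulrS; lra.
  by have := gD (c *+ N + x) (- x); rewrite addrK gM; lra.
have {stab}[g' g'P] := choice stab.
have g'_large x N1 : exists2 N, (N1 <= N)%N &
    forall M, (N <= M)%N -> g (c *+ M + x) = g' x + g c *+ M.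
  have [N0 N0P] := g'P x; exists (maxn N0 N1); first exact: leq_maxr.
  by move=> M; rewrite geq_max => /andP[/N0P <- _]; rewrite subrK.
exists g'; split.
- split=> [x y|k x].
    have [N1 _ N1P] := g'_large x 0%N; have [N2 N12 N2P] := g'_large y N1.
    have [N3 N23 N3P] := g'_large (x + y) N2.
    have := gD (c *+ N3 + x) (c *+ N3 + y).
    rewrite addrACA -mulrnDr N1P ?N2P ?N3P ?leq_addr//; last first.
      exact: leq_trans N23.
    by rewrite mulrnDr; lra.
  have [N1 _ N1P] := g'_large x 0%N; have [N2 N12 N2P] := g'_large (x *+ k) N1.
  case: k => [|k] in N2P *.
    by have := N2P N2 (leqnn _); rewrite !mulr0n addr0 gM; lra.
  have := gM k.+1 (c *+ N2 + x).
  rewrite N1P// mulrnDl -mulrnA N2P ?leq_pmulr// mulrnDl -mulrnA; lra.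
- move=> x; have [N _ /(_ _ (leqnn N)) NP] := g'_large x 0%N.
  by have := gD (c *+ N) x; rewrite NP gM; lra.
- have [N _ /(_ _ (leqnn N))] := g'_large c 0%N.
  by rewrite -mulrSr gM mulrSr; lra.
- have [[//|N] _ /(_ _ (leqnn _))] := g'_large (- c) 1%N.
  by rewrite mulrSr addrK gM mulrSr; lra.
Qed.

(** Linearity along c persists when g decreases further, so that directions can
    be treated one after the other. *)
Lemma int_sublinear_linear_at g g' c : int_sublinear g' ->
  (forall x, g' x <= g x) -> g (- c) = - g c ->
  g' c = g c /\ g' (- c) = - g' c.
Proof.
move=> g'S g'g gc; have := int_sublinear_opp c g'S.
have := g'g c; have := g'g (- c); rewrite gc; lra.
Qed.

Lemma int_sublinear_linearize_seq (s : seq V) g : int_sublinear g ->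
  exists g', [/\ int_sublinear g', forall x, g' x <= g x
    & forall c, c \in s -> g' (- c) = - g' c].
Proof.
elim: s g => [|c s IH] g gS; first by exists g.
have [g1 [g1S g1g g1c g1Nc]] := int_sublinear_linearize c gS.
have [g2 [g2S g21 g2s]] := IH _ g1S.
exists g2; split=> // [x|e]; first exact: le_trans (g21 x) (g1g x).
rewrite inE => /predU1P[->|/g2s//].
by apply: (int_sublinear_linear_at g2S g21 _).2; rewrite g1c.
Qed.

End IntegerHahnBanach.

(** Linearizing g along c and then along all the basis vectors leaves a linear
    function. *)
Lemma int_hahn_banach n (g : 'rV[int]_n -> int) (c : 'rV[int]_n) :
  int_sublinear g ->
  exists y : 'rV[int]_n, (forall x : 'rV[int]_n, \sum_i x 0 i * y 0 i <= g x) /\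
    \sum_i c 0 i * y 0 i = g c.
Proof.
move=> gS; have [g1 [g1S g1g g1c g1Nc]] := int_sublinear_linearize c gS.
have [g2 [g2S g21 g2e]] :=
  int_sublinear_linearize_seq [seq delta_mx 0 i | i : 'I_n] g1S.
have g2Z i (z : int) : g2 (z *: delta_mx 0 i) = z * g2 (delta_mx 0 i).
  have g2N k (e : 'rV[int]_n) : g2 (k%:Z *: e) = k%:Z * g2 e.
    by rewrite -natz scaler_nat g2S.2 mulr_natl.
  case: (intP z) => [|k|k]; rewrite ?g2N//.
  rewrite scaleNr -scalerN g2N mulNr g2e ?mulrN//.
  by apply/mapP; exists i; rewrite ?mem_enum.
have g2_sum (x : 'rV[int]_n) (r : seq 'I_n) : g2 (\sum_(i <- r) x 0 i *: delta_mx 0 i) <=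
    \sum_(i <- r) x 0 i * g2 (delta_mx 0 i).
  elim: r => [|i r IH]; first by rewrite !big_nil int_sublinear0.
  rewrite !big_cons; apply: le_trans (g2S.1 _ _) _.
  by rewrite g2Z lerD2l.
have g2E (x : 'rV[int]_n) : \sum_i x 0 i * g2 (delta_mx 0 i) = g2 x.
  have le1 := g2_sum x (index_enum 'I_n); rewrite -row_sum_delta in le1.
  have := g2_sum (- x) (index_enum 'I_n); rewrite -row_sum_delta.
  under eq_bigr do rewrite mxE mulNr; rewrite sumrN => le2.
  apply/eqP; rewrite eq_le le1 andbT.
  by apply: le_trans (int_sublinear_opp x g2S); rewrite lerNr.
exists (\row_i g2 (delta_mx 0 i)).
have E (x : 'rV[int]_n) : \sum_i x 0 i * (\row_i g2 (delta_mx 0 i)) 0 i = g2 x.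
  by rewrite -g2E; apply: eq_bigr => i _; rewrite mxE.
split=> [x|]; first by rewrite E (le_trans (g21 x)).
by rewrite E (int_sublinear_linear_at g2S g21 _).1 ?g1c// g1Nc.
Qed.

(** * Polytopes whose gauge is integral at lattice points *)

(** [G r x] stands for membership of x in the dilation by r of a convex set
    containing the origin; the relational form avoids infima and covers r = 0. *)
Record lattice_gauge (R : realType) (n : nat) (G : R -> 'rV[R]_n -> Prop) :
    Prop := LatticeGauge {
  gauge_bound : forall r x, G r x -> forall i, `|x 0 i| <= r;
  gauge_ge0 : forall r x, G r x -> 0 <= r;
  gauge0 : forall r, 0 <= r -> G r 0;
  gaugeD : forall r s x y, G r x -> G s y -> G (r + s) (x + y);
  gaugeZ : forall c r x, 0 <= c -> G r x -> G (c * r) (c *: x);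
  gauge_absorbing : exists M, forall x : 'rV[R]_n,
    (forall i, `|x 0 i| <= 1) -> G M x;
  gauge_integer : forall r x, lattice_point x -> G r x ->
    exists2 k : nat, k%:R <= r & G k%:R x;
  gauge_split : forall (k : nat) x, lattice_point x -> G k.+1%:R x ->
    exists e, [/\ lattice_point e, G 1 e & G k%:R (x - e)]
}.

Section LatticePoints.
Variables (R : realType) (n : nat).
Implicit Types x y : 'rV[R]_n.

Lemma lattice_pointP x :
  lattice_point x <-> exists z : 'rV[int]_n, x = map_mx intr z.
Proof.
split=> [/mxOverP xZ|[z ->]]; last first.
  by apply/mxOverP => i j; rewrite mxE intr_int.
exists (map_mx Num.floor x); apply/matrixP => i j.
by rewrite !mxE floorK.
Qed.

Lemma lattice_point0 : lattice_point (0 : 'rV[R]_n).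
Proof. by apply/mxOver0/rpred0. Qed.

Lemma lattice_pointB x y :
  lattice_point x -> lattice_point y -> lattice_point (x - y).
Proof.
by move=> /mxOverP xZ /mxOverP yZ; apply/mxOverP => i j; rewrite !mxE rpredB.
Qed.

Lemma dotp_intr (y z : 'rV[int]_n) :
  dotp (map_mx intr y : 'rV[R]_n) (map_mx intr z) =
    (\sum_i y 0 i * z 0 i)%:~R.
Proof.
by rewrite rmorph_sum; apply: eq_bigr => i _; rewrite !mxE rmorphM.
Qed.

Lemma finite_bounded_lattice (b : R) (A : set 'rV[R]_n) :
  (forall x, A x -> forall i, `|x 0 i| <= b) ->
  finite_set (A `&` @lattice_point R n).
Proof.
move=> Ab; pose k := (Num.truncn b).+1.
pose f (h : {ffun 'I_n -> 'I_(k + k).+1}) : 'rV[R]_n :=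
  \row_i ((h i : nat)%:Z - k%:Z)%:~R.
apply: (@sub_finite_set _ _ (f @` setT)); last exact/finite_image/finite_finset.
move=> x [Ax /lattice_pointP[z xz]].
have zk i : (`|z 0%R i| <= k)%N.
  have := Ab x Ax i; rewrite xz mxE -intr_norm -natr_absz => zb.
  by rewrite -(ler_nat R) (le_trans zb)// ltW// truncnS_gt.
exists [ffun i => inord (absz (z 0 i + k%:Z))] => //.
apply/rowP => i; rewrite xz !mxE ffunE; congr (_%:~R).
move: (z 0 i) (zk i) => zi zik; rewrite inordK; lia.
Qed.

End LatticePoints.

Section LatticeGauge.
Variables (R : realType) (n : nat) (G : R -> 'rV[R]_n -> Prop).
Hypothesis gG : lattice_gauge G.

Let A : set 'rV[R]_n := [set x | G 1 x].
Let Z : set 'rV[R]_n := @lattice_point R n.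

Let GZ := gaugeZ gG.
Let GD := gaugeD gG.

Lemma gauge_mono r s x : r <= s -> G r x -> G s x.
Proof.
move=> rs Gx; rewrite -[s](subrK r) -[x]add0r.
by apply: GD => //; apply: gauge0; rewrite ?subr_ge0.
Qed.

Lemma gauge_eq0 x : G 0 x -> x = 0.
Proof.
by move=> /(gauge_bound gG) x0; apply/rowP => i; rewrite mxE; apply/eqP;
  rewrite -normr_le0.
Qed.

Lemma gauge_absorbing_pos :
  exists2 M, 0 < M & forall x : 'rV[R]_n, (forall i, `|x 0 i| <= 1) -> G M x.
Proof.
have [M GM] := gauge_absorbing gG; exists (Num.max M 1).
  by rewrite lt_max ltr01 orbT.
by move=> x /GM; apply: gauge_mono; rewrite le_max lexx.
Qed.

Lemma gauge_total x : exists r, G r x.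
Proof.
have [M _ GM] := gauge_absorbing_pos.
pose c := 1 + \sum_i `|x 0 i|.
have c0 : 0 < c by rewrite ltr_wpDr// sumr_ge0.
exists (c * M); rewrite -[x](scalerKV (lt0r_neq0 c0)); apply: GZ; first exact: ltW.
apply: GM => i; rewrite mxE normrM normfV (gtr0_norm c0) ler_pdivrMl// mulr1.
rewrite /c (bigD1 i)//= addrCA lerDl.
by rewrite addr_ge0// sumr_ge0.
Qed.

Lemma gauge_decomposition (k : nat) x : lattice_point x -> G k%:R x ->
  exists b : 'I_k -> 'rV[R]_n,
    (forall i, A (b i) /\ lattice_point (b i)) /\ x = \sum_(i < k) b i.
Proof.
elim: k x => [|k IH] x xZ Gx.
  exists (fun=> 0); split; first by case.
  by rewrite big_ord0; exact: gauge_eq0.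
have [e [eZ Ge Gxe]] := gauge_split gG xZ Gx.
have [|b [bP xb]] := IH _ _ Gxe; first exact: lattice_pointB.
exists (fun i => if unlift ord0 i is Some j then b j else e).
split=> [i|]; first by case: unliftP.
rewrite big_ord_recl unlift_none; under eq_bigr do rewrite liftK.
by rewrite -xb addrC subrK.
Qed.

Lemma finite_gauge_lattice : finite_set (A `&` Z).
Proof. by apply: (@finite_bounded_lattice _ _ 1) => x /(gauge_bound gG). Qed.

Lemma convex_gauge : @convex_set R 'rV[R]_n A.
Proof.
apply/convex_setE => x y t /andP[t0 t1] Ax Ay.
have t1' : 0 <= 1 - t by rewrite subr_ge0.
by have := GD (GZ t0 Ax) (GZ t1' Ay); rewrite !mulr1 addrCA subrr addr0.
Qed.

(** A point y of A that is separated from the lattice points by C is approximated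
    by z / N, where z = floor (N y).  Being a lattice point of (N + M) A, z is a
    sum of at most N + M lattice points of A, hence C z <= (N + M) m, while
    C z = N C y + O(1).  This contradicts m < C y when N is large. *)
Lemma gauge_hull : A = convex_hull (A `&` Z).
Proof.
apply/seteqP; split; last first.
  by apply: convex_hull_sub; [exact: convex_gauge|move=> x []].
move=> y Ay; apply: contrapT => /(separate_finite_hull_int finite_gauge_lattice).
move=> [c]; set C := map_mx intr c => cP.
(* As C takes integer values at lattice points, the strict separation leaves
   a gap that does not depend on the point. *)
pose m : R := (Num.ceil (dotp C y) - 1)%:~R.
have Cm f : A f -> Z f -> dotp C f <= m.
  move=> Af Zf; have := cP f (conj Af Zf).
  have /lattice_pointP[z ->] := Zf; rewrite dotp_intr ler_int => Cf.
  suff : \sum_i c 0 i * z 0 i < Num.ceil (dotp C y) by lia.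
  by rewrite ceil_gt_int.
have m0 : 0 <= m.
  by rewrite -(dotp0r C) Cm//; [exact: (gauge0 gG)|exact: lattice_point0].
have my : m < dotp C y.
  by rewrite /m; have := ceilB1_lt (dotp C y).
have [M M0 GM] := gauge_absorbing_pos.
pose b := M * m + \sum_i `|C 0 i|.
suff Nb (N : nat) : N%:R * (dotp C y - m) <= b.
  have := Nb (Num.truncn (b / (dotp C y - m))).+1.
  by rewrite -ler_pdivlMr ?subr_gt0// leNgt truncnS_gt.
pose z : 'rV[R]_n := map_mx intr (map_mx Num.floor (N%:R *: y)).
have zZ : Z z by apply/lattice_pointP; eexists.
have yz i : `|(N%:R *: y - z) 0 i| <= 1.
  rewrite !mxE; set t := _ * y 0 i.
  have := floor_le t; have := floorD1_gt t; rewrite intrD => t1 t0.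
  by rewrite ger0_norm; lra.
have Gz : G (N%:R + M) z.
  have -> : z = N%:R *: y + (z - N%:R *: y) by rewrite addrC subrK.
  apply: GD; first by rewrite -[X in G X]mulr1; apply: GZ.
  by apply: GM => i; rewrite -opprB mxE normrN.
have [k kNM Gk] := gauge_integer gG zZ Gz.
have [e [eAZ zE]] := gauge_decomposition zZ Gk.
have Cz : dotp C z <= k%:R * m.
  rewrite zE dotp_sumr mulr_natl -[k in _ *+ k]card_ord -sumr_const.
  by apply: ler_sum => i _; have [] := eAZ i; exact: Cm.
have : dotp C z <= (N%:R + M) * m by apply: le_trans Cz _; exact: ler_wpM2r.
have := dotp_le_norm C yz; rewrite dotpC dotpBr dotpZr /b; lra.
Qed.

Lemma dual_gauge y r x : dual_polytope A y -> G r x -> dotp y x <= r.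
Proof.
move=> yA Gx; have := gauge_ge0 gG Gx; rewrite le_eqVlt => /predU1P[r0|r0].
  by move: Gx; rewrite -r0 => /gauge_eq0 ->; rewrite dotp0r.
rewrite -[x](scalerKV (lt0r_neq0 r0)) dotpZr -[leRHS]mulr1 ler_pM2l//.
apply: yA; rewrite /A/= -(mulVf (lt0r_neq0 r0)).
by apply: GZ => //; rewrite invr_ge0 ltW.
Qed.

Lemma finite_dual_lattice : finite_set (dual_polytope A `&` Z).
Proof.
have [M _ GM] := gauge_absorbing_pos.
apply: (@finite_bounded_lattice _ _ M) => y yA i.
have e1 j : `|(delta_mx 0 i : 'rV[R]_n) 0 j| <= 1.
  by rewrite mxE; case: (_ && _); rewrite ?normr0 ?normr1.
rewrite ler_norml -(dotp_delta y i) (dual_gauge yA (GM _ e1)) andbT.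
rewrite lerNl -mulN1r -dotpZr; apply: (dual_gauge yA); apply: GM => j.
by rewrite mxE mulN1r normrN.
Qed.

(** g is the restriction of the gauge of A to lattice points. *)
Lemma integer_gauge : exists g : 'rV[int]_n -> nat,
  (forall x, G (g x)%:R (map_mx intr x)) /\
  (forall r x, G r (map_mx intr x) -> (g x)%:R <= r).
Proof.
suff /choice[g gP] : forall x : 'rV[int]_n, exists k : nat,
    G k%:R (map_mx intr x) /\ forall r, G r (map_mx intr x) -> k%:R <= r.
  by exists g; split=> [x|r x]; have [] := gP x => // _; exact.
move=> x; have xZ : Z (map_mx intr x) by apply/lattice_pointP; exists x.
have exk : exists k : nat, `[< G k%:R (map_mx intr x) >].
  have [r Gr] := gauge_total (map_mx intr x).
  by have [k _ Gk] := gauge_integer gG xZ Gr; exists k; apply/asboolP.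
case: (ex_minnP exk) => k /asboolP Gk kmin; exists k; split=> // r Gr.
have [l lr Gl] := gauge_integer gG xZ Gr.
by apply: le_trans lr; rewrite ler_nat kmin//; apply/asboolP.
Qed.

Lemma integer_gauge_sublinear (g : 'rV[int]_n -> nat) :
  (forall x, G (g x)%:R (map_mx intr x)) ->
  (forall r x, G r (map_mx intr x) -> (g x)%:R <= r) ->
  int_sublinear (fun x => (g x)%:Z).
Proof.
move=> Gg gmin; split=> [x y|k x].
  rewrite -PoszD lez_nat -(ler_nat R) natrD; apply: gmin.
  by rewrite map_mxD; apply: GD.
have mapk : map_mx intr (x *+ k) = k%:R *: map_mx intr x :> 'rV[R]_n.
  by rewrite raddfMn scaler_nat.
rewrite -mulr_natr natz -PoszM.
apply/eqP; rewrite eqz_nat eqn_leq -!(ler_nat R); apply/andP; split.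
  by apply: gmin; rewrite mapk mulnC natrM; apply: GZ.
case: k mapk => [|k] mapk; first by rewrite muln0.
rewrite natrM -ler_pdivlMr// mulrC; apply: gmin.
rewrite -[map_mx intr x](@scalerK _ _ k.+1%:R) ?pnatr_eq0// -mapk.
by apply: GZ; rewrite ?invr_ge0.
Qed.

(** A lattice point of the dual is the same as an integral linear function below
    the integer gauge g.  Thus [int_hahn_banach] yields one with value g c at c,
    whereas no point of the dual exceeds this value. *)
Lemma dual_gauge_hull : dual_polytope A = convex_hull (dual_polytope A `&` Z).
Proof.
apply/seteqP; split; last first.
  by apply: convex_hull_sub; [exact: convex_dual_polytope|move=> x []].
move=> y0 y0A; apply: contrapT => /(separate_finite_hull_int finite_dual_lattice).
move=> [c cP]; have [g [Gg gmin]] := integer_gauge.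
have [y [yg yc]] := int_hahn_banach c (integer_gauge_sublinear Gg gmin).
have yA : dual_polytope A (map_mx intr y).
  suff : A `<=` [set x | dotp (map_mx intr y) x <= 1] by [].
  rewrite gauge_hull; apply: convex_hull_sub; first exact: convex_halfspace.
  move=> x [Ax /lattice_pointP[z xz]] /=; rewrite xz dotpC dotp_intr.
  have : (g z)%:R <= 1 :> R by apply: gmin; rewrite -xz.
  by apply: le_trans; rewrite pmulrn ler_int yg.
have lt_gc := cP _ (conj yA (proj2 (lattice_pointP _) (ex_intro _ y erefl))).
have le_gc := dual_gauge y0A (Gg c); rewrite dotpC in le_gc.
by move: (lt_le_trans lt_gc le_gc); rewrite dotp_intr yc -pmulrn ltxx.
Qed.

Lemma integral_lattice_hull (B : set 'rV[R]_n) :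
  finite_set (B `&` Z) -> B = convex_hull (B `&` Z) -> integral_polytope B.
Proof.
move=> finB BE; split; first by exists (B `&` Z).
by move=> x; rewrite BE => /vertex_convex_hull[].
Qed.

Lemma gauge_full_dim : full_dim_integral_polytope A.
Proof.
split; first exact: integral_lattice_hull finite_gauge_lattice gauge_hull.
have [M M0 GM] := gauge_absorbing_pos.
have unitM : ((M^-1)%:M : 'M[R]_n) \in unitmx.
  by rewrite unitmxE det_scalar unitrX// unitfE invr_neq0// gt_eqF.
exists 0, (M^-1)%:M; split.
- by rewrite row_free_unit.
- exact: (gauge0 gG).
- move=> i; rewrite add0r /A/= -(mulVf (lt0r_neq0 M0)) -scalemx1 linearZ/=.
  apply: GZ; first by rewrite invr_ge0 ltW.
  by apply: GM => j; rewrite !mxE; case: (_ == _); rewrite ?normr0 ?normr1.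
- by move=> x _; rewrite submx_full// row_full_unit.
Qed.

(** If x is interior, then (1 + t) x lies in A for some t > 0, so that x has gauge
    less than 1; for a lattice point this forces the gauge to be 0. *)
Lemma interior_gauge_lattice : interior A `&` Z = [set 0].
Proof.
have [M M0 GM] := gauge_absorbing_pos.
apply/seteqP; split=> [x [/nbhs_ballP[e/= e0 xeA] xZ]|x ->] /=; last first.
  split; last exact: lattice_point0.
  apply/nbhs_ballP; exists M^-1; rewrite /= ?invr_gt0// => z [_ Mz].
  rewrite /A/= -(mulVf (lt0r_neq0 M0)) -[z](scalerK (lt0r_neq0 M0)).
  apply: GZ; first by rewrite invr_ge0 ltW.
  apply: GM => i; rewrite mxE normrM (gtr0_norm M0) -ler_pdivlMl// mulr1.
  by have := Mz 0 i; rewrite -ball_normE /= mxE sub0r normrN => /ltW.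
pose t := e / (2 * (1 + `|x|)).
have x0 : 0 < 1 + `|x| by rewrite ltr_pwDl.
have t0 : 0 < t by rewrite divr_gt0// mulr_gt0.
have t1 : 0 < 1 + t by rewrite ltr_wpDl.
have : A ((1 + t) *: x).
  apply: xeA; rewrite -ball_normE /= scalerDl scale1r opprD addrA subrr sub0r.
  rewrite normrN normrZ (gtr0_norm t0) /t mulrAC ltr_pdivrMr ?mulr_gt0//.
  by rewrite ltr_pM2l//; have := normr_ge0 x; lra.
move=> /(GZ (ltW (_ : 0 < (1 + t)^-1))); rewrite invr_gt0 t1 => /(_ erefl).
rewrite scalerK ?gt_eqF// mulr1 => /(gauge_integer gG xZ)[k].
case: k => [|k] kt; first exact: gauge_eq0.
have : k.+1%:R < 1 :> R.
  by apply: le_lt_trans kt _; rewrite invf_lt1// ltrDl.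
by rewrite ltNge ler1n.
Qed.

Theorem lattice_gauge_polytope : normal_polytope A /\ gorenstein_fano A.
Proof.
split; last first.
  split; [exact: gauge_full_dim|exact: interior_gauge_lattice|].
  exact: integral_lattice_hull finite_dual_lattice dual_gauge_hull.
split; first exact: gauge_full_dim.
move=> N N0 a [x Ax <-] aZ; apply: gauge_decomposition => //.
by rewrite -[N%:R in X in G X _]mulr1; apply: GZ.
Qed.

End LatticeGauge.

(** * Omega of two families of dilations that are stable under floors *)

(** [D a u] stands for membership of u in the dilation by a of a polytope.  The
    last two fields are the combinatorial input: stability under floors, and
    the splitting of lattice points in integral dilations. *)
Record rounding_family (R : realType) (d : nat) (D : R -> 'rV[R]_d -> Prop) :
    Prop := RoundingFamily {
  family_ge0 : forall a u, D a u -> 0 <= a;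
  family_bound : forall a u, D a u -> forall i, 0 <= u 0 i <= a;
  family0 : forall a, 0 <= a -> D a 0;
  familyD : forall a b u v, D a u -> D b v -> D (a + b) (u + v);
  familyZ : forall c a u, 0 <= c -> D a u -> D (c * a) (c *: u);
  family_floor : forall a u, D a u ->
    D (Num.floor a)%:~R (map_mx (fun t => (Num.floor t)%:~R) u);
  family_split : forall (k : nat) u, lattice_point u -> D k.+1%:R u ->
    exists e, [/\ lattice_point e, D 1 e & D k%:R (u - e)]
}.

Lemma floorB_int (R : realType) (x y : R) : x - y \is a Num.int ->
  (Num.floor x)%:~R - (Num.floor y)%:~R = x - y.
Proof.
move=> xyZ; rewrite -{1}[x](subrK y) floorDzr// intrD addrK.
by rewrite floorK.
Qed.

Section OmegaGauge.
Variables (R : realType) (d : nat) (D E : R -> 'rV[R]_d -> Prop).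
Hypotheses (dD : rounding_family D) (dE : rounding_family E).
(* This provides an interior point w common to the two dilations by M. *)
Hypothesis DE : exists M w, E M w /\
  forall x : 'rV[R]_d, (forall i, `|x 0 i| <= 1) -> D M (x + w).

Definition omega_gauge (r : R) (z : 'rV[R]_(d + 1)) : Prop :=
  exists a b u v, [/\ D a u, E b v, a + b = r &
    z = row_mx (u - v) (const_mx (a - b))].

Lemma family_mono (F : R -> 'rV[R]_d -> Prop) a b u :
  rounding_family F -> a <= b -> F a u -> F b u.
Proof.
move=> dF ab Fau; rewrite -[b](subrK a) -[u]add0r.
by apply: (familyD dF) => //; apply: (family0 dF); rewrite subr_ge0.
Qed.

Lemma family_normalize (F : R -> 'rV[R]_d -> Prop) a u :
  rounding_family F -> F a u -> exists2 v, F 1 v & u = a *: v.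
Proof.
move=> dF Fau; have := family_ge0 dF Fau.
rewrite le_eqVlt => /predU1P[a0|a0]; last first.
  exists (a^-1 *: u); last by rewrite scalerKV ?gt_eqF.
  by rewrite -(mulVf (lt0r_neq0 a0)); apply: (familyZ dF); rewrite ?invr_ge0 ?ltW.
exists 0; first exact: (family0 dF).
apply/rowP => i; rewrite scaler0 mxE; apply/eqP; rewrite eq_le andbC.
by have := family_bound dF Fau i; rewrite -a0.
Qed.

Lemma omega_gauge_mono r s z : r <= s -> omega_gauge r z -> omega_gauge s z.
Proof.
move=> rs [a [b [u [v [Du Ev abr ->]]]]].
exists (a + (s - r) / 2), (b + (s - r) / 2), u, v; split.
- by apply: family_mono Du => //; lra.
- by apply: family_mono Ev => //; lra.
- by rewrite -abr; field.
- by congr (row_mx _ (const_mx _)); ring.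
Qed.

(** The key rounding step: as u - v and a - b are integral, taking floors of
    u, v, a and b changes neither difference. *)
Lemma omega_gauge_floor r z : lattice_point z -> omega_gauge r z ->
  exists (a b : nat) u v, [/\ D a%:R u, E b%:R v, lattice_point u,
    lattice_point v & a%:R + b%:R <= r /\
    z = row_mx (u - v) (const_mx (a%:R - b%:R))].
Proof.
move=> zZ [a [b [u [v [Du Ev <- zE]]]]].
have intz i : z 0 i \is a Num.int by move/mxOverP: zZ; exact.
pose fl (x : 'rV[R]_d) : 'rV[R]_d := map_mx (fun t => (Num.floor t)%:~R) x.
have flZ x : lattice_point (fl x).
  by apply/mxOverP => i j; rewrite mxE intr_int.
have floor_nat F c x : rounding_family F -> F c x ->
    exists2 k : nat, F k%:R (fl x) & (Num.floor c)%:~R = k%:R :> R.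
  move=> dF Fcx; have := family_floor dF Fcx.
  have : 0 <= Num.floor c by rewrite floor_ge0 (family_ge0 dF Fcx).
  by case: (Num.floor c) => // k _ Fk; exists k; rewrite // pmulrn.
have [k Dk ka] := floor_nat _ _ _ dD Du; have [l El lb] := floor_nat _ _ _ dE Ev.
exists k, l, (fl u), (fl v); split=> //; split.
  by rewrite -ka -lb lerD// floor_le.
rewrite zE; congr row_mx.
  apply/rowP => i; rewrite !mxE floorB_int//.
  by have := intz (lshift 1 i); rewrite zE row_mxEl !mxE.
rewrite -ka -lb floorB_int//.
by have := intz (rshift d 0); rewrite zE row_mxEr mxE.
Qed.

Lemma omega_gauge_split (k : nat) z : lattice_point z -> omega_gauge k.+1%:R z ->
  exists e, [/\ lattice_point e, omega_gauge 1 e & omega_gauge k%:R (z - e)].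
Proof.
move=> zZ /(omega_gauge_floor zZ)[a [b [u [v [Du Ev uZ vZ [abk ->]]]]]].
have row_int (x : 'rV[R]_d) (t : int) :
    lattice_point x -> lattice_point (row_mx x (const_mx t%:~R : 'rV[R]_1)).
  move=> /mxOverP xZ; apply/mxOverP => i j.
  by case: (split_ordP j) => l ->; rewrite ?row_mxEl ?row_mxEr ?xZ// mxE intr_int.
case: a Du abk => [|a] Du abk; last first.
  have [e [eZ De Due]] := family_split dD uZ Du.
  exists (row_mx e (const_mx 1)); split; first exact: (row_int _ 1).
    exists 1, 0, e, 0; split; rewrite ?addr0 ?subr0//; exact: (family0 dE).
  apply: (@omega_gauge_mono (a%:R + b%:R)).
    by move: abk; rewrite -!natrD !ler_nat.
  exists a%:R, b%:R, (u - e), v; split=> //.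
  rewrite opp_row_mx add_row_mx addrAC; congr row_mx.
  by apply/rowP => i; rewrite !mxE -natr1; ring.
case: b Ev abk => [|b] Ev abk; last first.
  have [e [eZ Ee Eve]] := family_split dE vZ Ev.
  exists (row_mx (- e) (const_mx (- 1))); split.
  - apply: (row_int _ (- 1)); rewrite -[- e]add0r.
    exact/lattice_pointB/eZ/lattice_point0.
  - by exists 0, 1, 0, e; split; rewrite ?add0r//; exact: (family0 dD).
  apply: (@omega_gauge_mono (0 + b%:R)).
    by move: abk; rewrite !add0r !ler_nat.
  exists 0, b%:R, u, (v - e); split=> //.
  rewrite opp_row_mx add_row_mx opprB opprK; congr row_mx; first by rewrite addrAC addrA.
  by apply/rowP => i; rewrite !mxE -natr1; ring.
exists 0; split; first exact: lattice_point0.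
  exists 2^-1, 2^-1, 0, 0; split.
  - by apply: (family0 dD); lra.
  - by apply: (family0 dE); lra.
  - by lra.
  - by rewrite !subrr -[LHS]row_mx0; congr row_mx; apply/rowP => i; rewrite !mxE.
apply: (@omega_gauge_mono (0 + 0)); first by rewrite addr0.
by exists 0, 0, u, v; split; rewrite ?subr0.
Qed.

Lemma omega_lattice_gauge : lattice_gauge omega_gauge.
Proof.
split.
- move=> r z [a [b [u [v [Du Ev <- ->]]]]] i.
  have a0 := family_ge0 dD Du; have b0 := family_ge0 dE Ev.
  case: (split_ordP i) => j ->; rewrite ?row_mxEl ?row_mxEr !mxE.
    have /andP[] := family_bound dD Du j; have /andP[] := family_bound dE Ev j.
    by rewrite ler_norml => *; apply/andP; split; lra.
  by rewrite ler_norml; apply/andP; split; lra.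
- move=> r z [a [b [u [v [Du Ev <- _]]]]].
  by rewrite addr_ge0 ?(family_ge0 dD Du) ?(family_ge0 dE Ev).
- move=> r r0; apply: (omega_gauge_mono r0).
  exists 0, 0, 0, 0; split; rewrite ?addr0//.
  + exact: (family0 dD).
  + exact: (family0 dE).
  + by rewrite !subrr -[LHS]row_mx0; congr row_mx; apply/rowP => i; rewrite !mxE.
- move=> _ _ _ _ [a [b [u [v [Du Ev <- ->]]]]] [a' [b' [u' [v' [Du' Ev' <- ->]]]]].
  exists (a + a'), (b + b'), (u + u'), (v + v'); split.
  + exact: (familyD dD).
  + exact: (familyD dE).
  + by rewrite addrACA.
  + rewrite add_row_mx opprD addrACA; congr row_mx.
    by apply/rowP => i; rewrite !mxE; ring.
- move=> c _ _ c0 [a [b [u [v [Du Ev <- ->]]]]].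
  exists (c * a), (c * b), (c *: u), (c *: v); split.
  + exact: (familyZ dD).
  + exact: (familyZ dE).
  + by rewrite mulrDr.
  + rewrite scale_row_mx scalerBr; congr row_mx.
    by apply/rowP => i; rewrite !mxE; ring.
- have [M [w [EMw DMw]]] := DE; exists (M + 1 + (M + 1)) => z z1.
  pose t := z 0 (rshift d 0).
  have : `|t| <= 1 by exact: z1.
  rewrite ler_norml => /andP[t_ge t_le].
  exists (M + 1 + t / 2), (M + 1 - t / 2), (lsubmx z + w), w; split.
  + apply: (@family_mono _ M) => //; first by lra.
    by apply: DMw => i; rewrite mxE.
  + by apply: (@family_mono _ M) => //; lra.
  + by ring.
  + rewrite addrK -[LHS]hsubmxK; congr row_mx; apply/rowP => i.
    by rewrite !mxE ord1 -/t; field.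
- move=> r z zZ /(omega_gauge_floor zZ)[a [b [u [v [Du Ev _ _ [abr ->]]]]]].
  exists (a + b)%N; first by rewrite natrD.
  by exists a%:R, b%:R, u, v; rewrite natrD.
- exact: omega_gauge_split.
Qed.

Lemma Omega_gauge : Omega [set x | D 1 x] [set x | E 1 x] =
  [set z | omega_gauge 1 z].
Proof.
apply/seteqP; split.
  apply: convex_hull_sub; first exact: convex_gauge omega_lattice_gauge.
  move=> z [[x Dx <-]|[x Ex <-]].
    exists 1, 0, x, 0; rewrite addr0 !subr0; split=> //; exact: (family0 dE).
  exists 0, 1, 0, x; rewrite !add0r; split=> //; exact: (family0 dD).
move=> z [a [b [u [v [Du Ev ab1 ->]]]]].
have a0 := family_ge0 dD Du; have b0 := family_ge0 dE Ev.
have [u' Du' ->] := family_normalize dD Du.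
have [v' Ev' ->] := family_normalize dE Ev.
have -> : row_mx (a *: u' - b *: v') (const_mx (a - b)) =
    a *: row_mx u' (const_mx 1) +
    (1 - a) *: row_mx (- v') (const_mx (- 1)) :> 'rV[R]_(d + 1).
  have -> : 1 - a = b by lra.
  rewrite !scale_row_mx add_row_mx scalerN; congr row_mx.
  by apply/rowP => i; rewrite !mxE; ring.
rewrite /Omega; set S := _ `|` _.
have /convex_setE := @convex_convex_hull _ _ S; apply.
- by rewrite a0 -ab1 lerDl.
- by apply: sub_convex_hull; left; exists u'.
- by apply: sub_convex_hull; right; exists v'.
Qed.

Theorem Omega_rounding_family :
  normal_polytope (Omega [set x | D 1 x] [set x | E 1 x]) /\
  gorenstein_fano (Omega [set x | D 1 x] [set x | E 1 x]).
Proof.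
by rewrite Omega_gauge; exact: lattice_gauge_polytope omega_lattice_gauge.
Qed.

End OmegaGauge.

(** * Order and chain polytopes *)

Lemma int_ltD1 (R : archiRealDomainType) (x y : R) : x \is a Num.int -> y \is a Num.int ->
  x < y -> x + 1 <= y.
Proof.
move=> /intrP[m ->] /intrP[n ->].
by rewrite ltr_int -[1]/(1%:~R) -intrD ler_int; lia.
Qed.

Section PosetDilations.
Variables (R : realType) (d : nat) (disp : Order.disp_t).
Variables (P : finPOrderType disp) (p : 'I_d -> P).
Hypothesis p_inj : injective p.

Definition order_dilation (a : R) (u : 'rV[R]_d) : Prop :=
  [/\ 0 <= a, forall i, 0 <= u 0 i <= a
    & forall i j, (p i <= p j)%O -> u 0 j <= u 0 i].

(** All chains are used instead of the maximal ones: this changes nothing for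
    nonnegative u, and [chain_split] needs chains that may not be maximal. *)
Definition chain_dilation (a : R) (u : 'rV[R]_d) : Prop :=
  [/\ 0 <= a, forall i, 0 <= u 0 i
    & forall C : {set P}, chain C -> \sum_(i < d | p i \in C) u 0 i <= a].

Lemma order_dilation1 : order_polytope p R = [set x | order_dilation 1 x].
Proof. by apply/seteqP; split=> x [] //=; split. Qed.

Lemma chain_dilation1 : chain_polytope p R = [set x | chain_dilation 1 x].
Proof.
apply/seteqP; split=> x /=; last first.
  by case=> _ x0 xC; split=> // C /maxsetp; exact: xC.
case=> x0 xC; split=> // C /maxset_exists[C' maxC' /fintype.subsetP CC'].
apply: le_trans (xC C' maxC'); rewrite big_mkcond [leRHS]big_mkcond/=.
apply: ler_sum => i _; have [/CC' -> //|_] := boolP (p i \in C).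
by case: ifP.
Qed.

(** The lattice point to split off from u is the indicator vector of its support,
    which is a down-set since u decreases along the order. *)
Lemma order_rounding_family : rounding_family order_dilation.
Proof.
split.
- by move=> a u [].
- by move=> a u [].
- by move=> a a0; split=> // [i|i j _]; rewrite !mxE ?lexx.
- move=> a b u v [a0 ua um] [b0 vb vm]; split=> [|i|i j pij].
  + exact: addr_ge0.
  + by have := ua i; have := vb i; rewrite mxE; lra.
  + by rewrite !mxE lerD ?um ?vm.
- move=> c a u c0 [a0 ua um]; split=> [|i|i j pij].
  + exact: mulr_ge0.
  + by have /andP[u0 ui] := ua i; rewrite mxE mulr_ge0// ler_wpM2l.
  + by rewrite !mxE ler_wpM2l ?um.
- move=> a u [a0 ua um]; split=> [|i|i j pij].
  + by rewrite ler0z floor_ge0.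
  + by have /andP[u0 ui] := ua i; rewrite mxE ler0z floor_ge0 u0 ler_int le_floor.
  + by rewrite !mxE ler_int le_floor ?um.
- move=> k u /mxOverP uZ [_ uk um].
  have ui1 i : 0 < u 0 i -> 1 <= u 0 i.
    by move=> ui; rewrite -[1]add0r int_ltD1.
  exists (\row_i (0 < u 0 i)%R%:R); split.
  + by apply/mxOverP => i j; rewrite mxE; case: ltP.
  + split=> // [i|i j /um uij]; rewrite !mxE; first by case: ltP; rewrite ?lexx ?ler01.
    by case: ltP => [uj|_]; [rewrite (lt_le_trans uj)|exact: ler0n].
  + split=> // [i|i j /um]; rewrite !mxE.
      have := uk i; have := ui1 i; rewrite -natr1; have := ler0n R k.
      by case: ltP => /= [ui k0 /(_ isT) ui_ge1|ui k0 _]; lra.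
    move=> uij; have /andP[uj0 _] := uk j.
    by have [uj|uj] := ltP 0 (u 0 j); have [/ui1 ui|ui] := ltP 0 (u 0 i);
      rewrite /= ?subr0; lra.
Qed.

(** The cardinality of [below i] is a height: it increases strictly along the
    order. *)
Definition below (i : 'I_d) : {set 'I_d} := [set j | (p j < p i)%O].

Lemma below_proper i j : (p i < p j)%O -> (#|below i| < #|below j|)%N.
Proof.
move=> pij; apply: proper_card; apply/properP; split.
  by apply/fintype.subsetP => l; rewrite !inE => /lt_trans; exact.
by exists i; rewrite !inE ?ltxx.
Qed.

Lemma chainP (C : {set P}) :
  reflect {in C &, forall x y, (x >=< y)%O} (chain C).
Proof.
apply: (iffP forall_inP) => [h x y /h/forall_inP|h x xC]; first exact.
by apply/forall_inP => y; exact: h.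
Qed.

(** The lattice point e to split off is the indicator vector of the minimal
    elements of the support of u.  A chain C that contains none of them has
    weight at most k: otherwise the lowest element of C in the support lies above
    some p j in the support, and adding p j to C would give a chain of weight
    more than k + 1. *)
Lemma chain_split (k : nat) u : lattice_point u -> chain_dilation k.+1%:R u ->
  exists e, [/\ lattice_point e, chain_dilation 1 e & chain_dilation k%:R (u - e)].
Proof.
move=> /mxOverP uZ [_ u0 uC].
have ui1 i : 0 < u 0 i -> 1 <= u 0 i.
  by move=> ui; rewrite -[1]add0r int_ltD1.
pose m i := (0 < u 0 i) && [forall j, (p j < p i)%O ==> (u 0 j == 0)].
have mP i j : m i -> (p j < p i)%O -> u 0 j = 0.
  by move=> /andP[_ /forallP/(_ j)/implyP] /[apply] /eqP.
exists (\row_i (m i)%:R); split.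
- by apply/mxOverP => i j; rewrite mxE; case: (m j).
- split=> // [i|C /chainP Cchain]; first by rewrite mxE ler0n.
  have [/existsP[i /andP[iC mi]]|] := boolP [exists i, (p i \in C) && m i].
    rewrite (bigD1 i)//= mxE mi big1 ?addr0// => j /andP[jC ji].
    rewrite mxE; have [mj|//] := boolP (m j).
    have ui : 0 < u 0 i by case/andP: mi.
    have uj : 0 < u 0 j by case/andP: mj.
    case: (comparable_ltgtP (Cchain _ _ iC jC)) => [pij|pji|/p_inj ij].
    - by move: ui; rewrite (mP _ _ mj pij) ltxx.
    - by move: uj; rewrite (mP _ _ mi pji) ltxx.
    - by rewrite ij eqxx in ji.
  rewrite negb_exists => /forallP nm; rewrite big1 ?ler01// => i iC.
  by have := nm i; rewrite iC mxE /= => /negPf ->.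
- split=> // [i|C Cch].
    by rewrite !mxE; case: (boolP (m i)) => [/andP[/ui1]|_]; rewrite ?subr0// subr_ge0.
  under eq_bigr do rewrite !mxE; rewrite sumrB.
  have [/existsP[i /andP[iC mi]]|nm] := boolP [exists i, (p i \in C) && m i].
    have : 1 <= \sum_(i < d | p i \in C) (m i)%:R :> R.
      by rewrite (bigD1 i)//= mi lerDl sumr_ge0.
    by have := uC C Cch; rewrite -natr1; lra.
  suff Ck : \sum_(i < d | p i \in C) u 0 i <= k%:R.
    by apply: le_trans Ck; rewrite gerBl sumr_ge0.
  have [/existsP[i0 i0C]|] := boolP [exists i, (p i \in C) && (0 < u 0 i)];
      last first.
    rewrite negb_exists => /forallP u00; rewrite big1// => i iC.
    by apply/eqP; rewrite eq_le u0 andbT leNgt; have := u00 i; rewrite iC.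
  (* The lowest element of C in the support has the fewest elements below it. *)
  have [i /andP[iC ui] imin] := @arg_minnP _ i0
    (fun i => (p i \in C) && (0 < u 0 i)) (fun i => #|below i|) i0C.
  have [j pji uj] : exists2 j, (p j < p i)%O & 0 < u 0 j.
    move: nm; rewrite negb_exists => /forallP/(_ i); rewrite iC /m ui /=.
    rewrite negb_forall => /existsP[j]; rewrite negb_imply => /andP[pji uj].
    by exists j; rewrite // lt0r uj u0.
  have jC : ~~ ((p j \in C) && (0 < u 0 j)).
    by apply/negP => /imin; rewrite leqNgt below_proper.
  pose S := [set p l | l in [set l | (p l \in C) && (0 < u 0 l)]]%SET.
  have ltS x : x \in S -> (p j < x)%O.
    case/imsetP => l; rewrite inE => /andP[lC ul] ->.
    have /comparable_leP[pil|pli] := chainP _ Cch _ _ iC lC.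
      exact: lt_le_trans pji pil.
    by have := imin l; rewrite lC ul leqNgt below_proper// => /(_ isT).
  have SC x : x \in S -> x \in C.
    by case/imsetP => l; rewrite inE => /andP[lC _] ->.
  have C'ch : chain (p j |: S)%SET.
    apply/chainP => x y /setU1P[->|xS] /setU1P[->|yS].
    - exact: comparablexx.
    - by rewrite /Order.comparable (ltW (ltS _ yS)).
    - by rewrite /Order.comparable (ltW (ltS _ xS)) orbT.
    - by apply: (chainP _ Cch); exact: SC.
  have := uC _ C'ch; rewrite (bigD1 j)/= ?setU11// -natr1.
  have := ui1 j uj.
  suff : \sum_(i < d | p i \in C) u 0 i <=
    \sum_(i < d | (p i \in p j |: S)%SET && (i != j)) u 0 i by lra.
  rewrite big_mkcond [leRHS]big_mkcond/=; apply: ler_sum => l _.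
  case: ifP => lC; last by case: ifP.
  have [ul|ul] := ltP 0 (u 0 l); last by apply: le_trans ul _; case: ifP.
  have lj : l != j by apply: contraNneq jC => <-; rewrite lC.
  by rewrite lj setU1r//; apply: imset_f; rewrite inE lC.
Qed.

Lemma chain_rounding_family : rounding_family chain_dilation.
Proof.
split.
- by move=> a u [].
- move=> a u [_ u0 uC] i; rewrite u0/=.
  have Ci : chain [set p i]%SET.
    by apply/chainP => x y /finset.set1P-> /finset.set1P->; exact: comparablexx.
  apply: le_trans (uC _ Ci); rewrite (bigD1 i) ?set11//= lerDl.
  exact: sumr_ge0.
- move=> a a0; split=> // [i|C _]; first by rewrite mxE.
  by rewrite big1// => i _; rewrite mxE.
- move=> a b u v [a0 u0 uC] [b0 v0 vC]; split=> [|i|C Cch].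
  + exact: addr_ge0.
  + by rewrite mxE addr_ge0.
  + by under eq_bigr do rewrite mxE; rewrite big_split/= lerD ?uC ?vC.
- move=> c a u c0 [a0 u0 uC]; split=> [|i|C Cch].
  + exact: mulr_ge0.
  + by rewrite mxE mulr_ge0.
  + by under eq_bigr do rewrite mxE; rewrite -mulr_sumr ler_wpM2l ?uC.
- move=> a u [a0 u0 uC]; split=> [|i|C Cch].
  + by rewrite ler0z floor_ge0.
  + by rewrite mxE ler0z floor_ge0.
  + under eq_bigr do rewrite mxE.
    rewrite -rmorph_sum ler_int floor_ge_int; apply: le_trans (uC C Cch).
    by rewrite rmorph_sum; apply: ler_sum => i _; exact: floor_le.
- exact: chain_split.
Qed.

(** The heights are doubled so that a perturbation of each coordinate by at most 1
    cannot reverse an inequality between coordinates. *)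
Lemma order_dilation_interior (h : 'I_d -> nat) (M : R) (x : 'rV[R]_d) :
  (forall i, (0 < h i)%N) -> (forall i j, (p i < p j)%O -> (h j < h i)%N) ->
  \sum_i (1 + 2 * (h i)%:R) <= M -> (forall i, `|x 0 i| <= 1) ->
  order_dilation M (x + \row_i (2 * (h i)%:R)).
Proof.
move=> h0 hp hM x1.
have xb i : -1 <= x 0 i <= 1 by rewrite -ler_norml.
have hge i : 1 <= (h i)%:R :> R by rewrite ler1n.
have iM i : 1 + 2 * (h i)%:R <= M.
  apply: le_trans hM; rewrite (bigD1 i)//= lerDl; apply: sumr_ge0 => j _.
  by have := hge j; lra.
split=> [|i|i j].
- by apply: le_trans hM; apply: sumr_ge0 => i _; have := hge i; lra.
- by rewrite !mxE; have := xb i; have := hge i; have := iM i; lra.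
- rewrite le_eqVlt => /predU1P[/p_inj->//|/hp]; rewrite !mxE -(ler_nat R) -natr1.
  by have := xb i; have := xb j; lra.
Qed.

Lemma chain_dilation_interior (h : 'I_d -> nat) (M : R) (x : 'rV[R]_d) :
  (forall i, (0 < h i)%N) ->
  \sum_i (1 + 2 * (h i)%:R) <= M -> (forall i, `|x 0 i| <= 1) ->
  chain_dilation M (x + \row_i (2 * (h i)%:R)).
Proof.
move=> h0 hM x1.
have xb i : -1 <= x 0 i <= 1 by rewrite -ler_norml.
have hge i : 1 <= (h i)%:R :> R by rewrite ler1n.
split=> [|i|C _].
- by apply: le_trans hM; apply: sumr_ge0 => i _; have := hge i; lra.
- by rewrite !mxE; have := xb i; have := hge i; lra.
- apply: le_trans hM; rewrite big_mkcond; apply: ler_sum => i _.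
  by rewrite !mxE; have := xb i; have := hge i; case: ifP => _; lra.
Qed.

End PosetDilations.

Lemma order_order_height (d : nat) (dispP dispQ : Order.disp_t)
    (P : finPOrderType dispP) (Q : finPOrderType dispQ)
    (p : 'I_d -> P) (q : 'I_d -> Q) : common_linear_extension p q ->
  exists h : 'I_d -> nat, [/\ forall i, (0 < h i)%N,
    forall i j, (p i < p j)%O -> (h j < h i)%N &
    forall i j, (q i < q j)%O -> (h j < h i)%N].
Proof.
move=> [s [sp sq]]; pose t i := (s^-1)%g i.
have st i : s (t i) = i by rewrite permKV.
exists (fun i => d - t i)%N; split=> [i|i j|i j].
- by rewrite subn_gt0.
- by rewrite -{1}[i]st -{1}[j]st => /sp; have := ltn_ord (t j); lia.
- by rewrite -{1}[i]st -{1}[j]st => /sq; have := ltn_ord (t j); lia.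
Qed.

Lemma poset_height (d : nat) (disp : Order.disp_t) (P : finPOrderType disp)
    (p : 'I_d -> P) :
  exists h : 'I_d -> nat, (forall i, (0 < h i)%N) /\
    forall i j, (p i < p j)%O -> (h j < h i)%N.
Proof.
exists (fun i => d - #|below p i|)%N.
have ltd i : (#|below p i| < d)%N.
  rewrite -[X in (_ < X)%N]card_ord -cardsT; apply: proper_card.
  by apply/properP; split; [exact: finset.subsetT|exists i; rewrite !inE ?ltxx].
split=> [i|i j pij]; first by rewrite subn_gt0.
by rewrite ltn_sub2l// below_proper.
Qed.

Theorem theorem1p3 (R : realType) (d : nat) (hd : (0 < d)%N)
    (dispP dispQ : Order.disp_t)
    (P : finPOrderType dispP) (Q : finPOrderType dispQ)
    (p : 'I_d -> P) (q : 'I_d -> Q) (hp : bijective p) (hq : bijective q) :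
  (common_linear_extension p q ->
     normal_polytope (Omega (order_polytope p R) (order_polytope q R)) /\
     gorenstein_fano (Omega (order_polytope p R) (order_polytope q R))) /\
  (normal_polytope (Omega (order_polytope p R) (chain_polytope q R)) /\
   gorenstein_fano (Omega (order_polytope p R) (chain_polytope q R))) /\
  (normal_polytope (Omega (chain_polytope p R) (chain_polytope q R)) /\
   gorenstein_fano (Omega (chain_polytope p R) (chain_polytope q R))).
Proof.
have p_inj := bij_inj hp; have q_inj := bij_inj hq.
have norm0 i : `|(0 : 'rV[R]_d) 0 i| <= 1 by rewrite mxE normr0.
rewrite !order_dilation1 !chain_dilation1.
split=> [/order_order_height[h [h0 hP hQ]]|]; last split.
- apply: Omega_rounding_family; try exact: order_rounding_family.
  exists (\sum_i (1 + 2 * (h i)%:R)), (\row_i (2 * (h i)%:R)); split.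
    by rewrite -[X in order_dilation _ _ X]add0r; exact: order_dilation_interior.
  by move=> x x1; exact: order_dilation_interior.
- have [h [h0 hP]] := poset_height p.
  apply: Omega_rounding_family.
  + exact: order_rounding_family.
  + exact: chain_rounding_family.
  exists (\sum_i (1 + 2 * (h i)%:R)), (\row_i (2 * (h i)%:R)); split.
    by rewrite -[X in chain_dilation _ _ X]add0r; exact: chain_dilation_interior.
  by move=> x x1; exact: order_dilation_interior.
- pose h (i : 'I_d) := 1%N.
  apply: Omega_rounding_family; try exact: chain_rounding_family.
  exists (\sum_i (1 + 2 * (h i)%:R)), (\row_i (2 * (h i)%:R)); split.
    by rewrite -[X in chain_dilation _ _ X]add0r; exact: chain_dilation_interior.
  by move=> x x1; exact: chain_dilation_interior.
Qed.
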